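(* Let $K$ be a compact convex set and let $q \in \mathrm{co\text{-}ext}_{\mathbb{1}_K} A_{lsc}(K)$. Then there exists $\psi \in \partial_e K$ such that $q = I_{\{\psi\}}^{\infty}$.
   Context: A compact convex set $K$ is a nonempty compact convex subset of a Hausdorff locally convex space; $\partial_e K$ is its set of extreme points; $\mathbb{1}_K$ is the constant function $1$. $A_{lsc}(K)$ is the cone of affine lower semicontinuous functions $h : K \to (0,\infty]$, with the pointwise order and multiplication by scalars in $(0,\infty]$. A vector $q \in A_{lsc}(K)$ is co-extremal if $\{f \in A_{lsc}(K) : f \ge q\} = \{tq : 1 \le t \le \infty\}$. For $f,g\in A_{lsc}(K)$, $M(f,g) = \inf\{\mu > 0 : f \le \mu g\}$ (with $\inf\varnothing = \infty$). $\mathrm{co\text{-}ext}_{\mathbb{1}_K} A_{lsc}(K)$ is the set of co-extremal vectors $q$ of $A_{lsc}(K)$ with $M(\mathbb{1}_K,q) = 1$. For $\psi \in \partial_e K$, $I_{\{\psi\}}^{\infty} : K \to (0,\infty]$ is given by $I_{\{\psi\}}^{\infty}(\psi) = 1$ and $I_{\{\psi\}}^{\infty}(\rho) = \infty$ for $\rho \ne \psi$; it belongs to $A_{lsc}(K)$. *)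

(* Defs.v *)
From HB Require Import structures.
From mathcomp Require Import all_boot all_order all_algebra.
From mathcomp Require Import all_classical all_reals all_analysis.

Set Implicit Arguments.
Unset Strict Implicit.
Unset Printing Implicit Defensive.

Import Order.TTheory GRing.Theory Num.Theory.

Local Open Scope classical_set_scope.
Local Open Scope ring_scope.
Local Open Scope convex_scope.
Local Open Scope ereal_scope.

(* [tvsType R] is the library's interface for real locally convex spaces; it
   does not include separation. *)
Definition compact_convex (R : realType) (E : tvsType R) (K : set E) : Prop :=
  [/\ hausdorff_space E, K !=set0, compact K & convex_set K].

Definition extreme_points (R : realType) (E : lmodType R) (K : set E) : set E :=
  [set x | K x /\
    forall (y z : convex_lmodType E) (t : {i01 R}), K y -> K z ->
      (0 < t%:num < 1)%R -> x = y <| t |> z -> y = x /\ z = x].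

(* Functions on [K] have the subtype [{x : E | x \in K}] as domain, which the
   library equips with the topology induced by [E]. *)

(* The endpoints t = 0, 1 add no condition, since 0 * +oo = 0 in [\bar R]. *)
Definition affine_on (R : realType) (E : lmodType R) (K : set E)
    (h : K -> \bar R) : Prop :=
  forall (x y z : K) (t : {i01 R}),
    val z = (val x : convex_lmodType E) <| t |> val y ->
    h z = (t%:num)%:E * h x + (1 - t%:num)%:E * h y.

Definition A_lsc (R : realType) (E : tvsType R) (K : set E) :
    set (K -> \bar R) :=
  [set h | [/\ forall x, 0 < h x, affine_on h & lower_semicontinuous h]].

Definition co_extremal (R : realType) (E : tvsType R) (K : set E)
    (q : K -> \bar R) : Prop :=
  A_lsc q /\
  [set f | A_lsc f /\ forall x, q x <= f x] =
  [set f | exists t : \bar R, 1 <= t <= +oo /\ f = (fun x => t * q x)].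

(* [ereal_inf set0 = +oo]. *)
Definition M (R : realType) (T : Type) (f g : T -> \bar R) : \bar R :=
  ereal_inf [set mu%:E | mu in
    [set mu : R | (0 < mu)%R /\ forall x, f x <= mu%:E * g x]].

Definition co_ext (R : realType) (E : tvsType R) (K : set E)
    (u : K -> \bar R) : set (K -> \bar R) :=
  [set q | co_extremal q /\ M u q = 1].

Definition I_infty (R : realType) (T : eqType) (psi : T) : T -> \bar R :=
  fun rho => if rho == psi then 1 else +oo.

(* Main.v *)
Require Import Defs.
From HB Require Import structures.
From mathcomp Require Import all_boot all_order all_algebra.
From mathcomp Require Import all_classical all_reals all_analysis.
From mathcomp Require Import lra ring.

(* A vector q with M(1, q) = 1 has minimum 1, attained on a closed face F since q
   is lower semicontinuous on a compact set.  If g >= 1 is affine and lower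
   semicontinuous, the function equal to g on F and to +oo elsewhere lies in
   A_lsc(K) and dominates q, hence is a multiple t q.  Taking g = 1 gives
   q = 1 on F and q = +oo off F; in general g = t on F, so g is constant on F.
   As continuous linear functionals separate points, F is a single point, which
   is extreme because F is a face.  The separating functional is a minimal
   sublinear functional below the gauge of a convex neighbourhood of 0: minimal
   sublinear functionals are linear. *)

Set Implicit Arguments.
Unset Strict Implicit.
Unset Printing Implicit Defensive.
Import Order.TTheory GRing.Theory Num.Theory numFieldNormedType.Exports.
Local Open Scope classical_set_scope.
Local Open Scope ring_scope.

(** * Minimal sublinear functionals and the Hahn-Banach theorem *)

Section sublinear.
Context {R : realType} {E : lmodType R}.
Implicit Types (p : E -> R) (A : E -> set R) (x y v : E).

(** Homogeneity is an inequality because infima inherit it in this form; applying it to [s^-1] gives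
    equality. *)
Definition sublinear p :=
  (forall x y, p (x + y) <= p x + p y) /\
  (forall s x, 0 < s -> p (s *: x) <= s * p x).

Lemma sublinearZ p s x : sublinear p -> 0 < s -> p (s *: x) = s * p x.
Proof.
move=> [_ pZ] s0; apply/eqP; rewrite eq_le pZ//=.
have := pZ s^-1 (s *: x); rewrite invr_gt0 => /(_ s0).
by rewrite scalerA mulVf ?gt_eqF// scale1r mulrC -lter_pdivrMr ?invr_gt0// invrK mulrC.
Qed.

Lemma sublinear0 p : sublinear p -> p 0 = 0.
Proof. by move=> /sublinearZ/(_ (ltr0Sn _ 1)) => /(_ 0); rewrite scaler0; lra. Qed.

Lemma sublinear_ge_subN p x y : sublinear p -> p y - p (- x) <= p (x + y).
Proof.
by move=> [pD _]; rewrite lerBlDr; have := pD (x + y) (- x); rewrite addrC addKr.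
Qed.

(** Serves three times: for shifts, for lower bounds of chains and for gauges. *)
Lemma sublinear_inf A :
  (forall x, A x !=set0) -> (forall x, has_lbound (A x)) ->
  (forall x y a b, A x a -> A y b -> exists2 c, A (x + y) c & c <= a + b) ->
  (forall s x a, 0 < s -> A x a -> exists2 c, A (s *: x) c & c <= s * a) ->
  sublinear (fun x => inf (A x)).
Proof.
move=> A0 lA AD AZ; split=> [x y|s x s0].
  rewrite -lerBlDr; apply: lb_le_inf => // a Aa.
  rewrite lerBlDr -lerBlDl; apply: lb_le_inf => // b Ab.
  rewrite lerBlDl; have [c Ac] := AD _ _ _ _ Aa Ab.
  by apply: le_trans; exact: ge_inf.
rewrite -ler_pdivrMl//; apply: lb_le_inf => // a Aa.
rewrite ler_pdivrMl//; have [c Ac] := AZ _ _ _ s0 Aa.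
by apply: le_trans; exact: ge_inf.
Qed.

(* The largest sublinear functional below [p] whose value at [- v] is at most
   [- p v]. *)
Definition sublinear_shift p v x :=
  inf [set p (x + s *: v) - s * p v | s in [set s | 0 <= s]].

Lemma has_lbound_shift p v x : sublinear p ->
  has_lbound [set p (x + s *: v) - s * p v | s in [set s | 0 <= s]].
Proof.
(* For [s > 0], subadditivity gives [p (s *: v) - p (- x) <= p (x + s *: v)], where
   [p (s *: v) = s * p v]. *)
move=> sp; exists (- p (- x)) => _ [s /= s_ge0 <-]; move: s_ge0; rewrite le0r => /orP[/eqP->|s0].
  rewrite scale0r addr0 mul0r subr0.
  by have := sublinear_ge_subN x 0 sp; rewrite addr0 sublinear0// sub0r.
by have := sublinear_ge_subN x (s *: v) sp; rewrite (sublinearZ _ sp)//; lra.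
Qed.

Lemma sublinear_shift_sublinear p v : sublinear p -> sublinear (sublinear_shift p v).
Proof.
move=> sp.
apply: sublinear_inf => [x|x|x y _ _ [s /= s0 <-] [t /= t0 <-]|s x _ s0 [t /= t0 <-]].
- by exists (p (x + 0 *: v) - 0 * p v), 0 => /=.
- exact: has_lbound_shift.
- exists (p (x + y + (s + t) *: v) - (s + t) * p v).
    by exists (s + t) => //=; exact: addr_ge0.
  have := sp.1 (x + s *: v) (y + t *: v).
  by rewrite addrACA -scalerDl; lra.
- exists (p (s *: x + (s * t) *: v) - (s * t) * p v).
    by exists (s * t) => //=; rewrite mulr_ge0// ltW.
  by rewrite -scalerA -scalerDr (sublinearZ _ sp)// mulrBr mulrA.
Qed.

Lemma sublinear_shift_le p v x : sublinear p -> sublinear_shift p v x <= p x.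
Proof.
move=> sp; apply: ge_inf; first exact: has_lbound_shift.
by exists 0 => //=; rewrite scale0r addr0 mul0r subr0.
Qed.

Lemma sublinear_shiftN p v : sublinear p -> sublinear_shift p v (- v) <= - p v.
Proof.
move=> sp; apply: ge_inf; first exact: has_lbound_shift.
by exists 1 => //=; rewrite scale1r addNr mul1r sublinear0// sub0r.
Qed.

Lemma minimal_sublinear p : sublinear p ->
  exists m, [/\ sublinear m, forall x, m x <= p x &
    forall q, sublinear q -> (forall x, q x <= m x) -> q = m].
Proof.
move=> sp.
pose T := {q : E -> R | sublinear q /\ forall x, q x <= p x}.
(* The order is reversed, so that a maximal element in Zorn's lemma is a minimal functional; a chain
   is bounded by its pointwise infimum. *)
pose le (q r : T) := `[< forall x, sval r x <= sval q x >].
have [|r s t|s t||[m [sm mp]] mmin] := @Zorn T le.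
- by move=> q; apply/asboolP.
- by move=> /asboolP rs /asboolP st; apply/asboolP => x; exact: le_trans (rs x).
- case: s t => [s sp1] [t tp] /asboolP/= st /asboolP/= ts; apply: eq_exist.
  by apply/funext => x; apply/eqP; rewrite eq_le st ts.
- move=> C totC; have [[c0 Cc0]|C0] := pselect (C !=set0); last first.
    by exists (exist _ p (conj sp (fun=> lexx _))) => c Cc; case: C0; exists c.
  pose A x := [set sval c x | c in C].
  have lA x : has_lbound (A x).
    exists (- p (- x)) => _ [[c [sc cp]] Cc <-] /=.
    have := sublinear_ge_subN x 0 sc; rewrite addr0 sublinear0// sub0r.
    by apply: le_trans; rewrite lerN2.
  have sA : sublinear (fun x => inf (A x)).
    apply: sublinear_inf => // [x|x y _ _ [c Cc <-] [d Cd <-]|s x _ s0 [c Cc <-]].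
    + by exists (sval c0 x), c0.
    (* Of two functionals in the chain, the smaller one serves for both terms. *)
    + have [/asboolP cd|/asboolP dc] := totC _ _ Cc Cd.
        exists (sval d (x + y)); first by exists d.
        by apply: le_trans ((svalP d).1.1 _ _) _; rewrite lerD2r.
      exists (sval c (x + y)); first by exists c.
      by apply: le_trans ((svalP c).1.1 _ _) _; rewrite lerD2l.
    + exists (sval c (s *: x)); first by exists c.
      exact: (svalP c).1.2.
  have Ap x : inf (A x) <= p x.
    apply: le_trans ((svalP c0).2 x); apply: ge_inf => //.
    by exists c0.
  exists (exist _ (fun x => inf (A x)) (conj sA Ap)) => c Cc; apply/asboolP => x /=.
  by apply: ge_inf => //; exists c.
exists m; split => // q sq qm.
have qp x : q x <= p x by exact: le_trans (mp x).
by have /(congr1 sval) := mmin (exist _ q (conj sq qp)) (asboolT qm).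
Qed.

(* A minimal sublinear [m] equals each of its shifts, so [m (- v) <= - m v];
   oddness then turns subadditivity into additivity.  Minimizing below the shift
   of [p] at [v] pins down the value at [v]. *)
Lemma Hahn_Banach_sublinear p v : sublinear p ->
  exists f : {linear E -> R^o}, (forall x, f x <= p x) /\ f v = p v.
Proof.
move=> sp.
have [m [sm mp mmin]] := minimal_sublinear (sublinear_shift_sublinear v sp).
have mN x : m (- x) = - m x.
  have mx := mmin _ (sublinear_shift_sublinear x sm)
    (fun y => sublinear_shift_le x y sm).
  apply/eqP; rewrite eq_le -{1}mx sublinear_shiftN//=.
  by have := sublinear_ge_subN x 0 sm; rewrite addr0 sublinear0//; lra.
have mD x y : m (x + y) = m x + m y.
  apply/eqP; rewrite eq_le sm.1/=.
  by have := sublinear_ge_subN x y sm; rewrite mN; lra.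
have mZ s x : m (s *: x) = s * m x.
  have [s0|s0|->] := ltgtP s 0; last by rewrite scale0r mul0r sublinear0.
    rewrite -[s]opprK scaleNr mN sublinearZ ?oppr_gt0//; lra.
  by rewrite sublinearZ.
have ml : linear (m : E -> R^o) by move=> s x y; rewrite mD mZ.
pose f : {linear E -> R^o} := HB.pack (m : E -> R^o)
    (GRing.isLinear.Build R E R^o *:%R m ml).
have fp x : f x <= p x by exact: le_trans (sublinear_shift_le _ _ sp).
exists f; split => //; apply/eqP; rewrite eq_le fp/=.
by have := le_trans (mp (- v)) (sublinear_shiftN v sp); rewrite mN lerN2.
Qed.

End sublinear.

(** * Gauges of convex neighbourhoods and separation of points *)

Section gauge.
Context {R : realType} {E : tvsType R}.
Implicit Types (V : set E) (x y : E).

Definition gauge V x : R := inf [set r | 0 < r /\ V (r^-1 *: x)].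

Lemma has_lbound_gauge V x : has_lbound [set r : R | 0 < r /\ V (r^-1 *: x)].
Proof. by exists 0 => r [/ltW]. Qed.

Lemma convex_set_comb V (s : R) x y : convex_set V -> V x -> V y -> 0 <= s <= 1 ->
  V (s *: x + (1 - s) *: y).
Proof.
move=> cV Vx Vy /andP[s0 s1].
by have /set_mem := cV x y (Itv01 s0 s1) (mem_set Vx) (mem_set Vy).
Qed.

(** By continuity of scaling at [(0, x)], some [r > 0] has [r *: x] in [V]; the witness is
    [r^-1]. *)
Lemma absorbing V x : nbhs 0 V -> [set r : R | 0 < r /\ V (r^-1 *: x)] !=set0.
Proof.
move=> V0; have /= := @scale_continuous R E (0, x) V; rewrite scale0r => /(_ V0).
move=> [[A B]/= [A0 Bx] AB].
have [r [r0 Ar]] : exists r : R, 0 < r /\ A r.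
  have [e /= e0 eA] := A0; exists (e / 2); split; first by rewrite divr_gt0.
  by apply: eA; rewrite /= sub0r normrN gtr0_norm ?divr_gt0//; lra.
exists r^-1; split; first by rewrite invr_gt0.
by rewrite invrK; apply: (AB (r, x)); split => //=; exact: nbhs_singleton.
Qed.

Lemma gauge_sublinear V : nbhs 0 V -> convex_set V -> sublinear (gauge V).
Proof.
move=> V0 cV; apply: sublinear_inf => [x|x|x y r s [r0 Vr] [s0 Vs]|s x r s0 [r0 Vr]].
- exact: absorbing.
- exact: has_lbound_gauge.
- exists (r + s) => //; split; first exact: addr_gt0.
  have rs0 : 0 < r + s by exact: addr_gt0.
  have -> : (r + s)^-1 *: (x + y) =
      (r / (r + s)) *: (r^-1 *: x) + (1 - r / (r + s)) *: (s^-1 *: y).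
    rewrite scalerDr !scalerA; congr (_ *: _ + _ *: _); field.
      by rewrite !gt_eqF.
    by rewrite !gt_eqF.
  apply: convex_set_comb => //; apply/andP; split.
    by rewrite divr_ge0// ltW.
  by rewrite ler_pdivrMr// mul1r lerDl ltW.
- exists (s * r) => //; split; first exact: mulr_gt0.
  by rewrite invfM mulrC scalerA -mulrA mulVf ?gt_eqF// mulr1.
Qed.

Lemma gauge_le V (r : R) x : 0 < r -> V (r^-1 *: x) -> gauge V x <= r.
Proof. by move=> r0 Vx; apply: ge_inf; [exact: has_lbound_gauge|split]. Qed.

(** Were the gauge below 1, some [r < 1] would have [r^-1 *: x] in [V], and [x] is a convex
    combination of that point and 0. *)
Lemma gauge_ge1 V x : nbhs 0 V -> convex_set V -> ~ V x -> 1 <= gauge V x.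
Proof.
move=> V0 cV Vx; have [g1|//] := ltP (gauge V x) 1.
have [r [r0 Vr] r1] := inf_lt (absorbing x V0) g1.
exfalso; apply: Vx.
have := convex_set_comb (s := r) cV Vr (nbhs_singleton V0).
rewrite scaler0 addr0 scalerA divff ?gt_eqF// scale1r; apply.
by rewrite !ltW.
Qed.

Lemma gauge_continuous V (f : {linear E -> R^o}) : nbhs 0 V ->
  (forall x, f x <= gauge V x) -> continuous f.
Proof.
move=> V0 fV x; apply/cvgrPdist_le => e e0.
have near_le (k : R) : \forall y \near x, V (k *: (x - y)).
  have c : (fun y => k *: (x - y)) @ x --> k *: (x - x).
    have cB : continuous (fun y => x - y).
      move=> y; apply: (@continuous_comp E (E * E)%type E (fun y => (x, y))
        (fun z => z.1 - z.2)).
        by apply: (@cvg_pair _ _ _ _ (nbhs x)); [exact: cvg_cst|exact: cvg_id].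
      exact: sub_continuous.
    apply: (@continuous_comp E (R^o * E)%type E (fun y => (k, x - y))
      (fun z => z.1 *: z.2)).
      by apply: (@cvg_pair _ _ _ _ (nbhs (k : R^o))); [exact: cvg_cst|exact: cB].
    exact: scale_continuous.
  by apply: c; rewrite subrr scaler0.
(* [V] need not be symmetric, so the two bounds on [f (x - y)] use [e^-1 *: (x - y)] and its
   opposite. *)
near=> y; rewrite -raddfB ler_norml -lerN2 opprK -raddfN.
apply/andP; split; apply: le_trans (fV _) _; apply: gauge_le => //.
  by rewrite scalerN -scaleNr; near: y; exact: near_le.
by near: y; exact: near_le.
Unshelve. all: by end_near. Qed.

(** Some convex open [V] around 0 misses [x - y], so its gauge is at least 1 there; Hahn-Banach
    gives a functional below the gauge with that same value. *)
Lemma separating_functional x y : hausdorff_space E -> x != y ->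
  exists f : {linear E -> R^o}, continuous f /\ f x != f y.
Proof.
move=> hE xy; have xy0 : x - y != 0 by rewrite subr_eq0.
have := hE; rewrite open_hausdorff => /(_ _ _ xy0).
move=> [[A B]/= [/set_mem Ax /set_mem B0] [_ oB /eqP AB0]].
have [C cC [oC bC]] := @locally_convex R E.
have [V [CV V0] VB] := bC 0 B (open_nbhs_nbhs (conj oB B0)).
have oV : nbhs 0 V by apply: open_nbhs_nbhs; split => //; exact: oC.
have cV : convex_set V by apply: cC; rewrite inE.
have Vxy : ~ V (x - y) by move=> /VB Bxy; have : (A `&` B) (x - y) by []; rewrite AB0.
have [f [fV fxy]] := Hahn_Banach_sublinear (x - y) (gauge_sublinear oV cV).
exists f; split; first exact: gauge_continuous fV.
rewrite -subr_eq0 -linearB fxy gt_eqF//.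
exact: lt_le_trans ltr01 (gauge_ge1 oV cV Vxy).
Qed.
End gauge.

Local Open Scope ereal_scope.

(** * Lower semicontinuous functions on a compact set *)

Section lower_semicontinuity.
Context {R : realType} {E : topologicalType} (K : set E).

Lemma ereal_dense (a b : \bar R) : a < b -> exists2 c : R, a < c%:E & c%:E < b.
Proof.
case: a b => [r| |] [s| |] //.
- by rewrite lte_fin => rs; exists ((r + s) / 2)%R; rewrite lte_fin; lra.
- by exists (r + 1)%R; rewrite ?ltry// lte_fin; lra.
- by exists (s - 1)%R; rewrite ?ltNyr// lte_fin; lra.
- by exists 0%R; rewrite ?ltry ?ltNyr.
Qed.

(** Otherwise the sets [f < b] with [b > a] generate a proper filter; at a cluster point [x], lower
    semicontinuity at a level between [a] and [f x] is contradicted. *)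
Lemma compact_lsc_gt (f : K -> \bar R) (a : \bar R) : a < +oo -> compact K ->
  lower_semicontinuous f -> (forall x, a < f x) ->
  exists2 b : R, a < b%:E & forall x, b%:E <= f x.
Proof.
move=> ay cK lf af; apply: contrapT => nb.
have lt_f (b : R) : a < b%:E -> exists x, f x < b%:E.
  move=> ab; apply: contrapT => nx; apply: nb; exists b => // x.
  by rewrite leNgt; apply/negP => fx; apply: nx; exists x.
(* Sublevel sets are carried to [E] because compactness of [K] concerns filters on [E]. *)
pose F : set_system E := filter_from [set b : R | a < b%:E]
  (fun b => val @` [set x : K | f x < b%:E]).
have [b0 ab0 _] := ereal_dense ay.
have FF : ProperFilter F.
  apply: filter_from_proper => [|b /lt_f[x fx]]; last by exists (val x), x.
  apply: filter_from_filter; first by exists b0.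
  move=> b c /= ab ac; exists (Num.min b c).
    by rewrite /=; case: (leP b c).
  by move=> _ [x /= fx <-]; split; exists x => //=; apply: lt_le_trans fx _;
    rewrite lee_fin ge_min lexx ?orbT.
have FK : F K by exists b0 => // _ [x _ <-]; exact/set_mem/(valP x).
have [z [Kz clz]] := cK F FF FK.
pose x : K := exist _ z (mem_set Kz).
have [c ac cfx] := ereal_dense (af x).
have [V [_ [[W oW <-] /= Wz WV]] Vf] := lf x c cfx.
have Fc : F (val @` [set x : K | f x < c%:E]) by exists c.
have [_ [[y /= fy <-] Wy]] := clz _ _ Fc (open_nbhs_nbhs (conj oW Wz)).
by have := lt_trans (Vf y (WV y Wy)) fy; rewrite ltxx.
Qed.

End lower_semicontinuity.

(** * The face where a co-extremal vector equals 1 *)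

Section co_extremal.
Context {R : realType} {E : tvsType R} {K : set E}.
Implicit Types (q : K -> \bar R) (g : K -> R).

(** If [q x = r < 1], some [mu < r^-1] would satisfy [1 <= mu * r]. *)
Lemma M1_ge1 q : (forall x, 0 < q x) -> M (cst 1) q = 1 -> forall x, 1 <= q x.
Proof.
move=> q0 M1 x; rewrite leNgt; apply/negP.
have := q0 x; case qx: (q x) => [r| |]//; rewrite !lte_fin => r0 r1.
have : M (cst 1) q < r^-1%:E by rewrite M1 lte_fin invf_gt1.
move=> /ereal_inf_lt[_ [mu [mu0 /(_ x) muq] <-]].
move: muq; rewrite qx -EFinM lee_fin lte_fin => mur.
by rewrite -[ltRHS]mul1r ltr_pdivlMr// ltNge mur.
Qed.

(** If [q > 1] everywhere, compactness yields [q >= b > 1], hence [M (cst 1) q <= b^-1 < 1]. *)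
Lemma M1_attained q : compact K -> lower_semicontinuous q ->
  M (cst 1) q = 1 -> exists x, q x <= 1.
Proof.
move=> cK lq M1; apply: contrapT => nq.
have q1 x : 1 < q x by rewrite ltNge; apply/negP => qx; apply: nq; exists x.
have [b b1 bq] := compact_lsc_gt (ltry _) cK lq q1.
rewrite lte_fin in b1; have b0 : (0 < b)%R by exact: lt_trans b1.
have : M (cst 1) q <= b^-1%:E.
  apply: ereal_inf_lbound; exists b^-1%R => //; split; first by rewrite invr_gt0.
  move=> x; apply: (@le_trans _ _ (b^-1%:E * b%:E)).
    by rewrite -EFinM mulVf// gt_eqF.
  by rewrite lee_pmul2l// lte_fin invr_gt0.
by rewrite M1 lee_fin leNgt invf_lt1// b1.
Qed.

Definition on_face q g (x : K) : \bar R := if q x == 1 then (g x)%:E else +oo.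

(** A proper average of two values at least 1 equals 1 only if both do; this makes the set where [q]
    is 1 a face. *)
Lemma affine_eq1 q (x y z : K) (t : {i01 R}) : affine_on q ->
  (forall x, 1 <= q x) -> (0 < t%:num < 1)%R ->
  val z = conv t (val x : convex_lmodType E) (val y) ->
  (q z == 1) = (q x == 1) && (q y == 1).
Proof.
move=> aq q1 /andP[t0 t1] /aq ->.
have t1' : (0 < 1 - t%:num)%R by rewrite subr_gt0.
move: (q1 x) (q1 y).
case: (q x) => [r| |]//; case: (q y) => [s| |]// r1 s1; last first.
- by rewrite !gt0_muley ?lte_fin.
- by rewrite gt0_muley ?lte_fin// -EFinM.
- by rewrite [X in _ + X]gt0_muley ?lte_fin// -EFinM andbF.
rewrite -!EFinM -EFinD !eqe; rewrite !lee_fin in r1 s1.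
apply/eqP/andP => [|[/eqP-> /eqP->]]; last first.
  by rewrite !mulr1 addrC subrK.
move=> trs; have : (t%:num * (r - 1) + (1 - t%:num) * (s - 1) == 0)%R.
  by apply/eqP; move/eqP: trs; rewrite -subr_eq0 => /eqP <-; ring.
rewrite paddr_eq0 ?mulr_ge0 ?subr_ge0 ?(ltW t0) ?(ltW t1)//.
by rewrite !mulf_eq0 (gt_eqF t0) (gt_eqF t1') /= !subr_eq0 => /andP.
Qed.

Lemma A_lsc_on_face q g : A_lsc q -> (forall x, 1 <= q x) ->
  affine_on (EFin \o g) -> lower_semicontinuous (EFin \o g) ->
  (forall x, 0 < g x)%R -> A_lsc (on_face q g).
Proof.
move=> [_ aq lq] q1 ag lg g0; split.
- by move=> x; rewrite /on_face; case: ifP; rewrite ?ltry// lte_fin.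
- move=> x y z t zE.
  (* The endpoints are treated apart, since the face property needs both weights positive. *)
  have [t0|t0] := eqVneq t%:num%R 0%R.
    have -> : z = y.
      by apply: val_inj; rewrite zE [t](_ : _ = (0%:i01)%R) ?conv0//; apply: val_inj.
    by rewrite t0 mul0e add0e subr0 mul1e.
  have [t1|t1] := eqVneq t%:num%R 1%R.
    have -> : z = x.
      by apply: val_inj; rewrite zE [t](_ : _ = (1%:i01)%R) ?conv1//; apply: val_inj.
    by rewrite t1 subrr mul0e adde0 mul1e.
  have t01 : (0 < t%:num < 1)%R by rewrite !lt_neqAle t1 eq_sym t0 ge0 le1.
  have /andP[t0' t1'] := t01.
  have {}t1' : (0 < 1 - t%:num)%R by rewrite subr_gt0.
  rewrite /on_face (affine_eq1 aq q1 t01 zE).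
  case: (q x == 1); case: (q y == 1) => /=.
  + exact: ag zE.
  + by rewrite [X in _ + X]gt0_muley ?lte_fin// -EFinM.
  + by rewrite gt0_muley ?lte_fin// -EFinM.
  + by rewrite !gt0_muley ?lte_fin.
(* On the face, a neighbourhood for [g] works, as values off the face are [+oo]; off the face,
   [q > 1] nearby, so the value stays [+oo]. *)
- move=> x a; rewrite /on_face; case: ifPn => [_ /lg[V Vx Vg]|qx _].
    by exists V => // y /Vg/=; case: ifP; rewrite ?ltry.
  have /lq[V Vx Vq] : 1 < q x by rewrite lt_neqAle eq_sym qx q1.
  by exists V => // y /Vq; case: ifP => [/eqP->|]; rewrite ?ltxx ?ltry.
Qed.

(** [on_face q g] dominates [q] because [q = 1 <= g] on the face, so co-extremality applies. *)
Lemma co_ext_on_face q g : co_ext (cst 1) q ->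
  affine_on (EFin \o g) -> lower_semicontinuous (EFin \o g) ->
  (forall x, 1 <= g x)%R -> exists t, on_face q g = (fun x => t * q x).
Proof.
move=> [[Aq cq] M1] ag lg g1; have q1 := M1_ge1 (let: And3 q0 _ _ := Aq in q0) M1.
have /seteqP[+ _] := cq => /(_ (on_face q g)) [].
  split; first by apply: A_lsc_on_face => // x; exact: lt_le_trans (g1 x).
  by move=> x; rewrite /on_face; case: eqP => [->|_]; rewrite ?leey// lee_fin.
by move=> t [_ ->]; exists t.
Qed.

End co_extremal.

(** * Reduction of the face to one extreme point *)

Theorem theorem3p2 (R : realType) (E : tvsType R) (K : set E)
    (hK : compact_convex K) (q : K -> \bar R)
    (hq : co_ext (cst 1 : K -> \bar R) q) :
  exists psi : K, extreme_points K (val psi) /\ q = I_infty R psi.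
Proof.
have [hE _ cK _] := hK; have [[Aq _] M1] := hq; have [q0 aq lq] := Aq.
have q1 := M1_ge1 q0 M1.
have [psi qpsi] := M1_attained cK lq M1.
have {}qpsi : q psi = 1 by apply/eqP; rewrite eq_le qpsi q1.
(* The factor is identified by evaluating at [psi], where [q = 1]. *)
have face_cst g : affine_on (EFin \o g) -> lower_semicontinuous (EFin \o g) ->
    (forall x, 1 <= g x)%R ->
    forall x, (if q x == 1 then (g x)%:E else +oo) = (g psi)%:E * q x.
  move=> ag lg g1 x; have [t tq] := co_ext_on_face hq ag lg g1.
  have := congr1 (@^~ psi) tq; rewrite /on_face qpsi eqxx mule1 => ->.
  by have := congr1 (@^~ x) tq; rewrite /on_face.
have qE x : q x = if q x == 1 then 1 else +oo.
  rewrite (face_cst (cst 1%R)) ?mul1e// => [y z w t _|y a a1].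
    by rewrite /= !mule1 -EFinD addrC subrK.
  by exists setT => //; exact: filterT.
have q1_psi x : q x = 1 -> x = psi.
  move=> qx; apply/eqP; rewrite -val_eqE; apply: contrapT => /negP xpsi.
  have [f [fc fxpsi]] := separating_functional hE xpsi.
  have lf (c : R) : lower_semicontinuous (fun y : K => (f (val y) + c)%:E).
    move=> y a; rewrite lte_fin -ltrBlDr => acy.
    exists (val @^-1` [set u | a - c < f u]%R); last first.
      by move=> u /=; rewrite lte_fin ltrBlDr.
    apply: (@initial_continuous _ _ (val : K -> E)).
    exact: (cvgr_gt _ (fc (val y))).
  (* A lower bound [b] of [f] on [K] makes the shifted functional [f + (1 - b)] at least 1. *)
  have [b _ bf] : exists2 b : R, -oo < b%:E & forall y : K, b%:E <= (f (val y) + 0)%:E.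
    by apply: compact_lsc_gt => // y; exact: ltNyr.
  move/eqP: fxpsi; apply; apply: (addIr (1 - b)%R); apply: EFin_inj.
  have := face_cst (fun y => f (val y) + (1 - b))%R _ _ _ x.
  rewrite qx eqxx mule1; apply.
  - move=> y z w t /= ->.
    rewrite -!EFinM -EFinD; congr EFin.
    rewrite linearD !linearZ /=.
    by move: (f _) (f _) => u v; rewrite /GRing.scale/= /unstable.onem; ring.
  - exact: lf.
  - by move=> y; have := bf y; rewrite addr0 lee_fin; lra.
exists psi; split.
  split; first exact/set_mem/(valP psi).
  move=> y z t Ky Kz t01 E1.
  (* If [psi] is interior to a segment of [K], both endpoints lie in the face, hence equal [psi]. *)
  have := affine_eq1 (x := exist _ y (mem_set Ky)) (y := exist _ z (mem_set Kz))
    aq q1 t01 E1.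
  rewrite qpsi eqxx => /esym/andP[/eqP/q1_psi yE /eqP/q1_psi zE].
  by split; [rewrite -yE|rewrite -zE].
apply/funext => x; rewrite /I_infty qE; case: eqP => [/q1_psi ->|qx].
  by rewrite eqxx.
by case: eqP => // xpsi; case: qx; rewrite xpsi.
Qed.
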